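(* Suppose $p(z) = \sum_{j=0}^{d} p_j z^j \in \mathbb{C}[z]$ is stable and $p(0)=1$. Then for all $z\in\mathbb{C}$, \[ |p(z)| \leq \exp\left( \operatorname{Re}(p_1 z) + \frac{1}{2}\left(|p_1|^2 - 2\operatorname{Re}(p_2)\right)|z|^2\right). \] The inequality is sharp on the imaginary axis for stable $p \in \mathbb{R}[z]$ in the following sense: given $c_1,c_2 \in \mathbb{R}$ with $\gamma := \frac{1}{2}(c_1^2-2c_2)> 0$, there exist stable polynomials $p_n \in \mathbb{R}[z]$ of the form $p_n(z)=1+c_1z+c_2z^2 + (\text{terms of degree} \geq 3)$ such that for all $y\in\mathbb{R}$, \[ \lim_{n\to \infty} |p_n(iy)| = \exp(\gamma y^2). \]
   Context: A polynomial $p\in\mathbb{C}[z]$ is called stable if it has no zeros in $\mathbb{C}_+=\{z\in\mathbb{C}:\operatorname{Im} z>0\}$. Coefficients $p_j$ with $j>d$ are taken to be $0$. *)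

(* Defs.v *)
From HB Require Import structures.
From mathcomp Require Import all_boot all_order all_algebra.
From mathcomp Require Import reals topology normedtype sequences exp.
From mathcomp.real_closed Require Import complex.

Set Implicit Arguments.
Unset Strict Implicit.
Unset Printing Implicit Defensive.

Local Open Scope ring_scope.
Local Open Scope complex_scope.

Definition stable (R : realType) (p : {poly R[i]}) : Prop :=
  forall z : R[i], 0 < complex.Im z -> ~ root p z.

(* A real polynomial seen as an element of C[z]. *)
Definition cpoly (R : realType) (p : {poly R}) : {poly R[i]} :=
  map_poly (fun x : R => x%:C) p.

(* The norm `|z| on R[i] takes its values in R[i]; cabs z is the same modulus
   sqrt (Re z ^ 2 + Im z ^ 2) as an element of R. *)
Definition cabs (R : realType) (z : R[i]) : R := Normc.normc z.

(* Main.v *)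
Require Import Defs.
From HB Require Import structures.
From mathcomp Require Import all_boot all_order all_algebra.
From mathcomp Require Import classical_sets reals topology normedtype sequences exp.
From mathcomp.real_closed Require Import complex.
From mathcomp Require Import ring lra.

Set Implicit Arguments.
Unset Strict Implicit.
Unset Printing Implicit Defensive.

Import Order.TTheory GRing.Theory Num.Theory.
Import numFieldNormedType.Exports.

Local Open Scope classical_set_scope.
Local Open Scope ring_scope.
Local Open Scope complex_scope.

(**
Write p(z) as the product of the factors 1 + a z, where -1/a runs over the
roots. Stability says exactly that every a has nonpositive imaginary part.

Bound. Each factor satisfies |1 + w|^2 = 1 + 2 Re w + |w|^2
<= exp (2 Re w + |w|^2), by 1 + x <= exp x ([cabs_1D_le]). Multiplying over the
factors gives |p(z)| <= exp (Re (p_1 z) + 1/2 S |z|^2) with S = sum |a|^2, since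
p_1 = sum a. What remains is S <= |p_1|^2 - 2 Re p_2
([sum_sqr_cabs_le_coef]). By Newton's identity p_1^2 - 2 p_2 = sum a^2, the
right-hand side is 2 (Im p_1)^2 + sum ((Re a)^2 - (Im a)^2), so the claim
becomes sum (Im a)^2 <= (sum Im a)^2: here the common sign of the Im a is
used.

Sharpness. Equality is approached when all a are real and tend to 0, with
sum a = c_1 and sum a^2 = 2 gamma fixed. A power q^m of the quadratic
q = 1 + b z + t z^2 does this: both coefficient functionals p_1 and
p_1^2 - 2 p_2 are additive over products of polynomials with constant term 1
([psum_prod]), so b = c_1 / m and b^2 - 2 t = 2 gamma / m are forced, and t <= 0
as soon as c_1^2 <= 2 gamma m, which makes q real-rooted. On the imaginary axis
|q(iy)|^2 = 1 + 2 gamma y^2 / m + t^2 y^4 is squeezed between exponentials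
([cabs_quad_bounds]) whose m-th powers tend to exp (2 gamma y^2).
*)

(** * Power sums of the reciprocal roots *)

(** The second power sum of the reciprocal roots, written by Newton's identity
    in terms of the coefficients so that it makes sense without any roots; the
    constant term is meant to be 1. *)
Definition psum2 (K : comNzRingType) (p : {poly K}) : K := p`_1 ^+ 2 - p`_2 *+ 2.

(** The first two power sums are additive over products. The expansion of a
    polynomial into linear factors and the coefficients of a power are both
    instances. *)
Lemma psum_prod (K : comNzRingType) (I : Type) (s : seq I) (F : I -> {poly K}) :
  (forall i, (F i)`_0 = 1) ->
  [/\ (\prod_(i <- s) F i)`_0 = 1,
      (\prod_(i <- s) F i)`_1 = \sum_(i <- s) (F i)`_1
    & psum2 (\prod_(i <- s) F i) = \sum_(i <- s) psum2 (F i)].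
Proof.
move=> F0; elim: s => [|i s [p0 p1 p2]].
  by rewrite !big_nil /psum2 !coefC /= expr0n mul0rn subrr.
rewrite !big_cons; split; first by rewrite coef0M F0 p0 mulr1.
  by rewrite coefM !big_ord_recr big_ord0 /= F0 p0 p1; ring.
rewrite -p2 /psum2 !coefM !big_ord_recr !big_ord0 /= F0 p0; ring.
Qed.

Lemma psum2_linear (K : comNzRingType) (a : K) :
  [/\ (1 + a *: 'X : {poly K})`_0 = 1, (1 + a *: 'X : {poly K})`_1 = a
    & psum2 (1 + a *: 'X) = a ^+ 2].
Proof. by rewrite /psum2 !coefE /=; split; ring. Qed.

(** * The exponential bound for stable polynomials *)

(** Inversion z |-> -1/z preserves the closed lower half-plane, and the value 1
    at 0 both keeps the roots away from 0 and absorbs the leading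
    coefficient. *)
Lemma stable_factor (R : realType) (p : {poly R[i]}) :
  stable p -> p.[0] = 1 ->
  exists2 s : seq R[i], all (fun a => complex.Im a <= 0) s
    & p = \prod_(a <- s) (1 + a *: 'X).
Proof.
move=> p_stable p0; have [r pE] := closed_field_poly_normal p.
have lead_neq0 : lead_coef p != 0.
  by apply/eqP => l0; move: p0; rewrite pE l0 scale0r horner0 => /esym/eqP; rewrite oner_eq0.
have root_r z : z \in r -> root p z.
  by move=> zr; rewrite pE rootZ// root_prod_XsubC.
have r_neq0 z : z \in r -> z != 0.
  move=> /root_r; apply: contraTneq => ->.
  by rewrite /root p0 oner_eq0.
exists [seq - z^-1 | z <- r].
  apply/allP => _ /mapP[z zr ->].
  have : complex.Im z <= 0.
    by rewrite leNgt; apply/negP => /p_stable; apply; exact: root_r.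
  by case: z {zr} => x y /= y_le0; rewrite opprK mulr_le0_ge0// invr_ge0 addr_ge0// sqr_ge0.
have factorE z : z \in r -> 'X - z%:P = (- z) *: (1 + (- z^-1) *: 'X).
  move=> /r_neq0 z0; rewrite scalerDr scalerA mulrNN divff// scale1r addrC.
  by rewrite -mul_polyC mulr1 polyCN.
(* Extracting -z from each factor leaves a constant, which is p(0) = 1. *)
have {}pE : p = (lead_coef p * \prod_(z <- r) (- z)) *: \prod_(z <- r) (1 + - z^-1 *: 'X).
  rewrite -scalerA -scaler_prod {1}pE; congr (_ *: _).
  by rewrite !big_seq; apply: eq_bigr.
rewrite big_map {1}pE.
suff -> : lead_coef p * \prod_(z <- r) - z = 1 by rewrite scale1r.
move: p0; rewrite {1}pE hornerZ horner_prod [X in _ * X]big1 ?mulr1// => z _.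
by rewrite !hornerE /= ?mulr0 ?addr0.
Qed.

Lemma cabsM (R : realType) (z w : R[i]) : cabs (z * w) = cabs z * cabs w.
Proof. exact: Normc.normcM. Qed.

Lemma cabs_ge0 (R : realType) (z : R[i]) : 0 <= cabs z.
Proof. by case: z => x y; exact: sqrtr_ge0. Qed.

Lemma cabsX (R : realType) (z : R[i]) n : cabs (z ^+ n) = cabs z ^+ n.
Proof.
elim: n => [|n ih]; first by rewrite !expr0; exact: Normc.normc1.
by rewrite !exprS cabsM ih.
Qed.

Lemma sqr_cabs (R : realType) (z : R[i]) :
  cabs z ^+ 2 = complex.Re z ^+ 2 + complex.Im z ^+ 2.
Proof. by case: z => x y; rewrite sqr_sqrtr// addr_ge0// sqr_ge0. Qed.

(** The elementary factor of the bound; it follows from 1 + x <= exp x applied to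
    |1 + w|^2 - 1. *)
Lemma cabs_1D_le (R : realType) (w : R[i]) :
  cabs (1 + w) <= expR (complex.Re w + 1 / 2 * cabs w ^+ 2).
Proof.
rewrite -ler_sqr ?nnegrE ?cabs_ge0 ?expR_ge0// sqr_cabs sqr_cabs.
rewrite -expRM_natl; apply: le_trans (expR_ge1Dx _).
case: w => x y /=; nra.
Qed.

(** The cross terms of the square of the sum are products of two nonpositive
    numbers. *)
Lemma sumr_sqr_le_sqr_sum (R : realDomainType) (s : seq R) :
  all (fun x => x <= 0) s ->
  \sum_(x <- s) x ^+ 2 <= (\sum_(x <- s) x) ^+ 2.
Proof.
elim: s => [|x s ih] /=; first by rewrite !big_nil expr0n.
move=> /andP[x_le0 s_le0]; rewrite !big_cons.
have S_le0 : \sum_(y <- s) y <= 0.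
  by rewrite big_seq; apply: sumr_le0 => y /(allP s_le0).
have := ih s_le0; have := mulr_le0 x_le0 S_le0; nra.
Qed.

Lemma psum_prod_linear (K : comNzRingType) (s : seq K) (p : {poly K}) :
  p = \prod_(a <- s) (1 + a *: 'X) ->
  p`_1 = \sum_(a <- s) a /\ psum2 p = \sum_(a <- s) a ^+ 2.
Proof.
have lin (a : K) := psum2_linear a; move=> ->.
have [|_ -> ->] := @psum_prod K K s (fun a => 1 + a *: 'X).
  by move=> a; case: (lin a).
by split; apply: eq_bigr => a _; case: (lin a).
Qed.

(** This is where stability enters quantitatively: |p_1|^2 exceeds Re (p_1^2) by
    2 (Im p_1)^2, and the absence of cancellation in Im p_1 lets this excess
    turn each Re (a^2) into |a|^2. *)
Lemma sum_sqr_cabs_le_coef (R : realType) (s : seq R[i]) (p : {poly R[i]}) :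
  all (fun a => complex.Im a <= 0) s -> p = \prod_(a <- s) (1 + a *: 'X) ->
  \sum_(a <- s) cabs a ^+ 2 <= cabs p`_1 ^+ 2 - 2 * complex.Re p`_2.
Proof.
move=> s_lower /psum_prod_linear[p1 p2].
have ImE : complex.Im p`_1 = \sum_(a <- s) complex.Im a by rewrite p1 raddf_sum.
have ReE : complex.Re (psum2 p) = \sum_(a <- s) (complex.Re a ^+ 2 - complex.Im a ^+ 2).
  by rewrite p2 raddf_sum; apply: eq_bigr => -[x y] _.
have -> : cabs p`_1 ^+ 2 - 2 * complex.Re p`_2 =
    2 * complex.Im p`_1 ^+ 2 + complex.Re (psum2 p).
  by rewrite sqr_cabs /psum2; case: (p`_1) => a b; case: (p`_2) => c d /=; ring.
rewrite ImE ReE.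
have Im_sqr_le :
    \sum_(a <- s) complex.Im a ^+ 2 <= (\sum_(a <- s) complex.Im a) ^+ 2.
  have := @sumr_sqr_le_sqr_sum _ (map (@complex.Im R) s).
  by rewrite !big_map all_map; apply.
apply: (@le_trans _ _ (2 * \sum_(a <- s) complex.Im a ^+ 2
    + \sum_(a <- s) (complex.Re a ^+ 2 - complex.Im a ^+ 2))); last first.
  by rewrite lerD2r ler_pM2l.
rewrite mulr_sumr -big_split /=.
by apply: ler_sum => a _; rewrite sqr_cabs; lra.
Qed.

Lemma stable_bound (R : realType) (p : {poly R[i]}) (z : R[i]) :
  stable p -> p.[0] = 1 ->
  cabs p.[z] <=
    expR (complex.Re (p`_1 * z)
          + 1 / 2 * (cabs p`_1 ^+ 2 - 2 * complex.Re p`_2) * cabs z ^+ 2).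
Proof.
move=> p_stable p0; have [s s_lower pE] := stable_factor p_stable p0.
have coef_ge := sum_sqr_cabs_le_coef s_lower pE.
have [p1 _] := psum_prod_linear pE.
apply: (@le_trans _ _ (expR (complex.Re (p`_1 * z)
    + 1 / 2 * (\sum_(a <- s) cabs a ^+ 2) * cabs z ^+ 2))); last first.
  by rewrite ler_expR lerD2l ler_wpM2r ?sqr_ge0// ler_pM2l// divr_gt0.
rewrite p1 mulr_suml raddf_sum -mulrA mulr_suml mulr_sumr -big_split /=.
rewrite expR_sum {1}pE horner_prod.
have -> : cabs (\prod_(a <- s) (1 + a *: 'X).[z]) =
    \prod_(a <- s) cabs (1 + a *: 'X).[z].
  exact: (big_morph _ (@cabsM R) (Normc.normc1 R)).
apply: ler_prod => a _; rewrite cabs_ge0 /=.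
have -> : (1 + a *: 'X).[z] = 1 + a * z by rewrite !hornerE.
by rewrite -exprMn -cabsM; exact: cabs_1D_le.
Qed.

(** * Polynomials approaching equality *)

(** A converse of 1 + x <= exp x with a quadratic error, which vanishes in the
    limit when x is of order 1 / m and the m-th power is taken. *)
Lemma expR_sub_sqr_le (R : realType) (x : R) :
  0 <= x -> expR (x - x ^+ 2) <= 1 + x.
Proof.
move=> x_ge0; have x1_gt0 : 0 < 1 + x by rewrite ltr_wpDr.
(* 1 + u <= exp u at this u reads 1 / (1 + x) <= exp (- x / (1 + x)). *)
have := expR_ge1Dx (- (x / (1 + x))).
have -> : 1 + - (x / (1 + x)) = (1 + x)^-1 by field; rewrite gt_eqF.
rewrite expRN lef_pV2 ?posrE ?expR_gt0//; apply: le_trans.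
rewrite ler_expR ler_pdivlMr//; have := mulr_ge0 x_ge0 (sqr_ge0 x); nra.
Qed.

Definition quad (R : realType) (b t : R) : {poly R} := 1 + b *: 'X + t *: 'X^2.

Lemma cpoly_horner_quadX (R : realType) (b t : R) m (z : R[i]) :
  (cpoly (quad b t ^+ m)).[z] = (1 + b%:C * z + t%:C * z ^+ 2) ^+ m.
Proof.
rewrite /cpoly rmorphXn horner_exp /quad !rmorphD rmorph1 /= !map_polyZ map_polyX map_polyXn.
by rewrite !hornerE.
Qed.

(** For t <= 0 the discriminant b^2 - 4 t is nonnegative, so the roots are real.
    The proof avoids square roots: at a nonreal root x + i y, the imaginary part
    gives b = - 2 t x, and the real part is then 1 - t (x^2 + y^2) > 0. *)
Lemma stable_quadX (R : realType) (b t : R) m :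
  t <= 0 -> stable (cpoly (quad b t ^+ m)).
Proof.
move=> t_le0 [x y] /= y_gt0; rewrite /root cpoly_horner_quadX expf_eq0 => /andP[_].
rewrite eq_complex /= => /andP[/eqP re0 /eqP im0].
have {}im0 : (b + 2 * t * x) * y = 0 by rewrite -im0; ring.
move/eqP: im0; rewrite mulf_eq0 (gt_eqF y_gt0) orbF => /eqP im0.
have : 1 + - t * (x ^+ 2 + y ^+ 2) = 0.
  have bE : b = - 2 * t * x by lra.
  by rewrite -re0 bE; ring.
apply/eqP; rewrite gt_eqF// ltr_wpDr// mulr_ge0 ?oppr_ge0//.
by rewrite addr_ge0// sqr_ge0.
Qed.

Lemma quadX_coef (R : realType) (b t : R) m :
  [/\ (quad b t ^+ m)`_0 = 1, (quad b t ^+ m)`_1 = m%:R * b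
    & psum2 (quad b t ^+ m) = m%:R * (b ^+ 2 - 2 * t)].
Proof.
have q0 : (quad b t)`_0 = 1 by rewrite !coefE /=; ring.
have q1 : (quad b t)`_1 = b by rewrite !coefE /=; ring.
have q2 : psum2 (quad b t) = b ^+ 2 - 2 * t by rewrite /psum2 q1 !coefE /=; ring.
have [] := psum_prod (index_enum 'I_m) (fun _ : 'I_m => q0).
rewrite !prodr_const !sumr_const card_ord => -> -> ->.
by rewrite q1 q2 !mulr_natl.
Qed.

(** With b^2 - 2 t = 2 g, the coefficient of y^2 in
    |1 + b (iy) + t (iy)^2|^2 = 1 + 2 g y^2 + t^2 y^4 depends on g alone, and
    t <= 0 gives |t| <= g. Hence the modulus is exp (g y^2) up to an error
    of order g^2 in the exponent. *)
Lemma cabs_quad_bounds (R : realType) (b t g y : R) :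
  t <= 0 -> b ^+ 2 - 2 * t = 2 * g ->
  expR (g * y ^+ 2 - 2 * (g * y ^+ 2) ^+ 2)
    <= cabs (1 + b%:C * (0 +i* y) + t%:C * (0 +i* y) ^+ 2)
    <= expR (g * y ^+ 2 + 1 / 2 * (g * y ^+ 2) ^+ 2).
Proof.
move=> t_le0 gE.
have g_ge0 : 0 <= g by have := sqr_ge0 b; lra.
have gy_ge0 : 0 <= g * y ^+ 2 by rewrite mulr_ge0// sqr_ge0.
apply/andP; split.
  rewrite -ler_sqr ?nnegrE ?cabs_ge0 ?expR_ge0// -expRM_natl.
  have -> : 2%:R * (g * y ^+ 2 - 2 * (g * y ^+ 2) ^+ 2) =
      (2 * (g * y ^+ 2)) - (2 * (g * y ^+ 2)) ^+ 2 by ring.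
  apply: le_trans (expR_sub_sqr_le _) _; first by rewrite mulr_ge0.
  rewrite sqr_cabs /=.
  have := sqr_ge0 (t * y ^+ 2); have : g = (b ^+ 2 - 2 * t) / 2 by lra.
  move=> ->; nra.
rewrite -addrA; apply: le_trans (cabs_1D_le _) _; rewrite ler_expR sqr_cabs /=.
have : (t * y ^+ 2) ^+ 2 <= (g * y ^+ 2) ^+ 2.
  rewrite !exprMn ler_wpM2r ?sqr_ge0// -(sqrrN t) lerXn2r ?nnegrE ?oppr_ge0//.
  by have := sqr_ge0 b; lra.
have : g = (b ^+ 2 - 2 * t) / 2 by lra.
by move=> ->; nra.
Qed.

Lemma cvg_expR_affine_harmonic (R : realType) (a d : R) :
  (fun n : nat => expR (a + d * harmonic n)) @ \oo --> expR a.
Proof.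
have lin_cvg : (fun n : nat => a + d * harmonic n) @ \oo --> a.
  rewrite -[X in _ --> X]addr0 -[X in _ --> _ + X](mulr0 d).
  by apply: cvgD; [exact: cvg_cst|apply: cvgMl_tmp; exact: cvg_harmonic].
exact: (continuous_cvg _ (@continuous_expR R a) lin_cvg).
Qed.

(** The limiting argument: m equal quadratics, with g = gamma / m in
    [cabs_quad_bounds], so that the error in the exponent of the m-th power is
    of order 1 / m. *)
Lemma sharp_approximants (R : realType) (c1 c2 gamma : R) :
  gamma = 1 / 2 * (c1 ^+ 2 - 2 * c2) -> 0 < gamma ->
  exists p_ : nat -> {poly R},
    (forall n : nat,
      stable (cpoly (p_ n)) /\
      (p_ n)`_0 = 1 /\ (p_ n)`_1 = c1 /\ (p_ n)`_2 = c2) /\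
    (forall y : R,
      (fun n : nat => cabs (cpoly (p_ n)).[0 +i* y]) @ \oo
        --> expR (gamma * y ^+ 2)).
Proof.
move=> gammaE gamma_gt0.
(* The shift by k makes c1 ^ 2 <= 2 gamma m hold for every n, so that t <= 0,
   while m >= n + 1 lets 1 / m be bounded by the harmonic sequence. *)
pose k := Num.truncn (c1 ^+ 2 / (2 * gamma)).
pose m n := (n + k).+1.
have m_gt0 n : 0 < (m n)%:R :> R by rewrite ltr0n.
have m_neq0 n : (m n)%:R != 0 :> R by rewrite gt_eqF.
pose b n : R := c1 / (m n)%:R.
pose t n : R := (b n ^+ 2 - 2 * (gamma / (m n)%:R)) / 2.
have t_le0 n : t n <= 0.
  have : c1 ^+ 2 / (2 * gamma) <= (m n)%:R.
    by apply: le_trans (ltW (truncnS_gt _)) _; rewrite ler_nat ltnS leq_addl.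
  rewrite ler_pdivrMr ?mulr_gt0// => c1_le.
  have -> : t n = (c1 ^+ 2 - (m n)%:R * (2 * gamma)) / (2 * (m n)%:R ^+ 2).
    by rewrite /t /b; field.
  by rewrite mulr_le0_ge0 ?subr_le0// invr_ge0 mulr_ge0// sqr_ge0.
have gE n : b n ^+ 2 - 2 * t n = 2 * (gamma / (m n)%:R) by rewrite /t; field.
exists (fun n => quad (b n) (t n) ^+ m n); split=> [n|y].
  have [q0 q1 q2] := quadX_coef (b n) (t n) (m n).
  have {}q1 : (quad (b n) (t n) ^+ m n)`_1 = c1 by rewrite q1 /b; field.
  split; [exact: stable_quadX|do 2!split=> //].
  move: q2; rewrite /psum2 q1 gE => q2.
  have : c1 ^+ 2 - 2 * (quad (b n) (t n) ^+ m n)`_2 = 2 * gamma.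
    by rewrite mulr_natl q2; field.
  lra.
apply: (@squeeze_cvgr _ _ _ R
  (fun n => expR (gamma * y ^+ 2 + - 2 * (gamma * y ^+ 2) ^+ 2 * harmonic n))
  (fun n => expR (gamma * y ^+ 2 + 1 / 2 * (gamma * y ^+ 2) ^+ 2 * harmonic n))).
- apply: nearW => n; rewrite cpoly_horner_quadX cabsX.
  have /andP[lo hi] := cabs_quad_bounds y (t_le0 n) (gE n).
  have m_inv : (m n)%:R^-1 <= harmonic n :> R.
    by rewrite lef_pV2 ?posrE// ler_nat ltnS leq_addr.
  have sqr_le := ler_wpM2l (sqr_ge0 (gamma * y ^+ 2)) m_inv.
  apply/andP; split.
    apply: le_trans (lerXn2r (m n) _ _ lo); rewrite ?nnegrE ?expR_ge0 ?cabs_ge0//.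
    rewrite -expRM_natl ler_expR.
    have -> : (m n)%:R * (gamma / (m n)%:R * y ^+ 2 - 2 * (gamma / (m n)%:R * y ^+ 2) ^+ 2)
        = gamma * y ^+ 2 - 2 * ((gamma * y ^+ 2) ^+ 2 * (m n)%:R^-1) by field.
    lra.
  apply: le_trans (lerXn2r (m n) _ _ hi) _; rewrite ?nnegrE ?expR_ge0 ?cabs_ge0//.
  rewrite -expRM_natl ler_expR.
  have -> : (m n)%:R * (gamma / (m n)%:R * y ^+ 2 + 1 / 2 * (gamma / (m n)%:R * y ^+ 2) ^+ 2)
      = gamma * y ^+ 2 + 1 / 2 * ((gamma * y ^+ 2) ^+ 2 * (m n)%:R^-1) by field.
  lra.
- exact: cvg_expR_affine_harmonic.
- exact: cvg_expR_affine_harmonic.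
Qed.

Theorem theorem1p3 (R : realType) :
  (forall p : {poly R[i]}, stable p -> p.[0] = 1 ->
    forall z : R[i],
      cabs p.[z] <=
        expR (complex.Re (p`_1 * z)
              + 1 / 2 * (cabs p`_1 ^+ 2 - 2 * complex.Re p`_2) * cabs z ^+ 2))
  /\
  (forall c1 c2 gamma : R,
    gamma = 1 / 2 * (c1 ^+ 2 - 2 * c2) -> 0 < gamma ->
    exists p_ : nat -> {poly R},
      (forall n : nat,
        stable (cpoly (p_ n)) /\
        (p_ n)`_0 = 1 /\ (p_ n)`_1 = c1 /\ (p_ n)`_2 = c2) /\
      (forall y : R,
        (fun n : nat => cabs (cpoly (p_ n)).[0 +i* y]) @ \oo
          --> expR (gamma * y ^+ 2))).
Proof.
split=> [p p_stable p0 z|c1 c2 gamma]; first exact: stable_bound.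
exact: sharp_approximants.
Qed.
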